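(* Let $\mathcal Z_{r_1}=\{\zeta\in\mathbb R^L:H_{r_1}\zeta+q_{r_1}\ge 0\}$ ($r_1=1,\dots,s_1$), $\mathcal Z_{r_2}=\{\zeta\in\mathbb R^L:H_{r_2}\zeta+q_{r_2}\ge 0\}$ ($r_2=1,\dots,s_2$), $\mathcal Z_d=\{\zeta\in\mathbb R^L:H_d\zeta+q_d\ge 0\}$ ($d=1,\dots,D$). Then the second stage robust SBM model with these polyhedral uncertainty sets is equivalent to the following polynomial-size (second-order conic) optimization problem: $$\max\ w_k^2$$ subject to $$w_k^2-p_2-\frac1{s_1+s_2}\Big(\sum_{r_1=1}^{s_1}c^D_{r_1k}-\sum_{r_2=1}^{s_2}c^U_{r_2k}\Big)\le 0,\qquad p_2-\frac1D\sum_{d=1}^{D}b_{dk}\le 1,$$ $$-p_2z_{dk}^0+\sum_{j=1}^{n}z_{dj}^0\lambda_j'+S_{dk}+\sum_{k_1=1}^{K}q_d^{k_1}v_{d,k_1}\le 0\ \ \forall d,\qquad \sum_{k_1=1}^{K}h^d_{\ell k_1}v_{d,k_1}+\sum_{j=1}^{n}z_{dj}^\ell\lambda_j'-p_2z_{dk}^\ell=0\ \ \forall d,\ell,$$ $$p_2y_{r_1k}^{D,0}-\sum_{j=1}^{n}y_{r_1j}^{D,0}\lambda_j'+S^D_{r_1k}+\sum_{k_1=1}^{K}q_{r_1}^{k_1}v^1_{r_1,k_1}\le 0\ \ \forall r_1,\qquad \sum_{k_1=1}^{K}h^{r_1}_{\ell k_1}v^1_{r_1,k_1}+p_2y_{r_1k}^{D,\ell}-\sum_{j=1}^{n}y_{r_1j}^{D,\ell}\lambda_j'=0\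 \ \forall r_1,\ell,$$ $$-p_2y_{r_2k}^{U,0}+\sum_{j=1}^{n}y_{r_2j}^{U,0}\lambda_j'+S^U_{r_2k}+\sum_{k_1=1}^{K}q_{r_2}^{k_1}v^2_{r_2,k_1}\le 0\ \ \forall r_2,\qquad \sum_{k_1=1}^{K}h^{r_2}_{\ell k_1}v^2_{r_2,k_1}+\sum_{j=1}^{n}y_{r_2j}^{U,\ell}\lambda_j'-p_2y_{r_2k}^{U,\ell}=0\ \ \forall r_2,\ell,$$ $$p_2-\sum_{j=1}^{n}\lambda_j'=0,$$ $$y_{r_1k}^{D,0}c^D_{r_1k}-S^D_{r_1k}+\sum_{k_1=1}^{K}q_{r_1}^{k_1}v^3_{r_1,k_1}\le 0\ \ \forall r_1,\qquad \sum_{k_1=1}^{K}h^{r_1}_{\ell k_1}v^3_{r_1,k_1}+y_{r_1k}^{D,\ell}c^D_{r_1k}=0\ \ \forall r_1,\ell,$$ $$y_{r_2k}^{U,0}c^U_{r_2k}-S^U_{r_2k}+\sum_{k_1=1}^{K}q_{r_2}^{k_1}v^4_{r_2,k_1}\le 0\ \ \forall r_2,\qquad \sum_{k_1=1}^{K}h^{r_2}_{\ell k_1}v^4_{r_2,k_1}+y_{r_2k}^{U,\ell}c^U_{r_2k}=0\ \ \forall r_2,\ell,$$ $$z_{dk}^0b_{dk}-S_{dk}+\sum_{k_1=1}^{K}q_d^{k_1}v^5_{d,k_1}\le 0\ \ \forall d,\qquad \sum_{k_1=1}^{K}h^d_{\ell k_1}v^5_{d,k_1}+z_{dk}^\ell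 b_{dk}=0\ \ \forall d,\ell,$$ $$p_2>0,\quad\lambda_j'\ge 0\ \forall j,\quad S_{dk}\ge 0,\quad S^D_{r_1k}\ge 0,\quad S^U_{r_2k}\ge 0,\quad v,v^1,v^2,v^3,v^4,v^5\ge 0.$$ (Equivalent: a point in the variables of the robust model is feasible for it if and only if it can be completed by values of the auxiliary variables $v,v^1,\dots,v^5$ to a feasible point of the displayed problem; the objectives coincide.)
   Context: There are $n$ decision-making units $DMU_1,\dots,DMU_n$, and $k\in\{1,\dots,n\}$ is fixed. Intermediates $z_{dj}$ ($d=1,\dots,D$), desirable outputs $y^D_{r_1j}$ ($r_1=1,\dots,s_1$) and undesirable outputs $y^U_{r_2j}$ ($r_2=1,\dots,s_2$) of $DMU_j$ depend affinely on $\zeta\in\mathbb R^L$: $z_{dj}(\zeta)=z_{dj}^0+\sum_{\ell}\zeta_\ell z_{dj}^\ell$, $y^D_{r_1j}(\zeta)=y_{r_1j}^{D,0}+\sum_\ell\zeta_\ell y_{r_1j}^{D,\ell}$, $y^U_{r_2j}(\zeta)=y_{r_2j}^{U,0}+\sum_\ell\zeta_\ell y_{r_2j}^{U,\ell}$, $\ell=1,\dots,L$, with real nominal values and deviations. $H_{r_1},H_{r_2},H_d\in\mathbb R^{K\times L}$ and $q_{r_1},q_{r_2},q_d\in\mathbb R^K$; $h^{r_1}_{\ell k_1},h^{r_2}_{\ell k_1},h^d_{\ell k_1}$ are the entries of $H_{r_1},H_{r_2},H_d$ in row $k_1$ and column $\ell$, and $q^{k_1}_{r_1},q^{k_1}_{r_2},q^{k_1}_d$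 the $k_1$-th coordinates of $q_{r_1},q_{r_2},q_d$. The second stage robust SBM model with uncertainty sets $\mathcal Z_{r_1},\mathcal Z_{r_2},\mathcal Z_d\subset\mathbb R^L$ is: maximize $w_k^2$ subject to - $w_k^2-p_2-\frac1{s_1+s_2}\big(\sum_{r_1}c^D_{r_1k}-\sum_{r_2}c^U_{r_2k}\big)\le 0$ and $p_2-\frac1D\sum_d b_{dk}\le 1$; - $p_2z_{dk}(\zeta)-\sum_jz_{dj}(\zeta)\lambda_j'-S_{dk}\ge 0$ and $z_{dk}(\zeta)b_{dk}-S_{dk}\le 0$, each for all $\zeta\in\mathcal Z_d$, for every $d$; - $p_2y^D_{r_1k}(\zeta)-\sum_jy^D_{r_1j}(\zeta)\lambda_j'+S^D_{r_1k}\le 0$ and $y^D_{r_1k}(\zeta)c^D_{r_1k}-S^D_{r_1k}\le 0$, each for all $\zeta\in\mathcal Z_{r_1}$, for every $r_1$; - $-p_2y^U_{r_2k}(\zeta)+\sum_jy^U_{r_2j}(\zeta)\lambda_j'+S^U_{r_2k}\le 0$ and $y^U_{r_2k}(\zeta)c^U_{r_2k}-S^U_{r_2k}\le 0$, each for all $\zeta\in\mathcal Z_{r_2}$, for every $r_2$; - $p_2-\sum_j\lambda_j'=0$, $p_2>0$, $\lambda_j'\ge 0$, $S_{dk}\ge 0$, $S^D_{r_1k}\ge 0$, $S^U_{r_2k}\ge 0$. Decision variables: real $w_k^2,p_2,\lambda_j',S_{dk},b_{dk},S^D_{r_1k},c^D_{r_1k},S^U_{r_2k},c^U_{r_2k}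$.
   Formalization: The polyhedral uncertainty sets $\mathcal Z_{r_1}$, $\mathcal Z_{r_2}$, $\mathcal Z_d$ are assumed nonempty; for an empty set the robust constraints hold vacuously while the displayed equations can fail, so the claim is false as stated. *)

(* Defs.v *)
(* MathComp; the real numbers are an arbitrary [R : realType]. *)
From mathcomp Require Export all_boot all_order all_algebra.
From mathcomp Require Export classical_sets reals.

Set Implicit Arguments.
Unset Strict Implicit.
Unset Printing Implicit Defensive.

Import Order.TTheory GRing.Theory Num.Theory.
Local Open Scope ring_scope.

(* A maximization problem over the decision space [V]. *)
Record max_problem (R : realType) (V : Type) := MaxProblem {
  objective : V -> R;
  feasible : V -> Prop }.

(* [Q] has the variables [V] of [P] together with auxiliary variables [A]. *)
Definition equivalent_by_completion (R : realType) (V A : Type)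
    (P : max_problem R V) (Q : max_problem R (V * A)) : Prop :=
  (forall x : V, feasible P x <-> exists a : A, feasible Q (x, a)) /\
  (forall (x : V) (a : A), objective Q (x, a) = objective P x).

Definition l2norm (R : realType) (m : nat) (u : 'rV[R]_m) : R :=
  Num.sqrt (\sum_i u 0 i ^+ 2).

(* |A x + b| <= c x + d, or |A x + b| < c x + d if [soc_strict]. The strict form
   is there for sign conditions such as p > 0; dimension 0 gives linear
   inequalities. *)
Record soc_constraint (R : realType) (V : vectType R) := SocConstraint {
  soc_dim : nat;
  soc_A : 'Hom(V, 'rV[R]_soc_dim);
  soc_b : 'rV[R]_soc_dim;
  soc_c : 'Hom(V, R^o);
  soc_d : R;
  soc_strict : bool }.

Definition soc_holds (R : realType) (V : vectType R) (c : soc_constraint V)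
    (x : V) : Prop :=
  l2norm (soc_A c x + soc_b c) < soc_c c x + soc_d c ?<= if ~~ soc_strict c.

Arguments soc_holds {R V} c x.

(* maximize f x subject to finitely many second-order cone constraints and
   linear equations F_i x = g_i. *)
Record socp (R : realType) (V : vectType R) := Socp {
  socp_f : 'Hom(V, R^o);
  socp_m : nat;
  socp_cone : 'I_socp_m -> soc_constraint V;
  socp_p : nat;
  socp_F : 'I_socp_p -> 'Hom(V, R^o);
  socp_g : 'I_socp_p -> R }.

Arguments socp_m {R V} s.
Arguments socp_cone {R V} s i.
Arguments socp_p {R V} s.
Arguments socp_F {R V} s i.
Arguments socp_g {R V} s i.

Definition socp_problem (R : realType) (V : vectType R) (C : socp V) :
    max_problem R V :=
  MaxProblem
    (fun x => socp_f C x)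
    (fun x => (forall i, soc_holds (socp_cone C i) x) /\
              (forall i, socp_F C i x = socp_g C i)).

(* Number of scalars in the data of [C]: one row of [\dim V] coefficients and a
   constant term for the objective, for each equation, and for each of the
   [soc_dim + 1] affine forms of each cone constraint. *)
Definition socp_size (R : realType) (V : vectType R) (C : socp V) : nat :=
  ((\dim {: V}).+1 *
   (1 + socp_p C + \sum_(i < socp_m C) (soc_dim (socp_cone C i)).+1))%N.

Definition same_problem (R : realType) (V : Type) (P Q : max_problem R V) :
    Prop :=
  (forall x, feasible P x <-> feasible Q x) /\
  (forall x, objective P x = objective Q x).

(* Nominal values ([_0]) and deviations ([_dev l]); rows are the measures,
   columns the decision-making units. *)
Record sbm_data (R : realType) (n D s1 s2 L : nat) := SbmData {
  z0 : 'M[R]_(D, n);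
  zdev : 'I_L -> 'M[R]_(D, n);
  yD0 : 'M[R]_(s1, n);
  yDdev : 'I_L -> 'M[R]_(s1, n);
  yU0 : 'M[R]_(s2, n);
  yUdev : 'I_L -> 'M[R]_(s2, n) }.

Definition perturbed (R : realType) (m n L : nat) (a0 : 'M[R]_(m, n))
    (adev : 'I_L -> 'M[R]_(m, n)) (zeta : 'cV[R]_L) (i : 'I_m) (j : 'I_n) : R :=
  a0 i j + \sum_(l < L) zeta l 0 * adev l i j.

Definition polyhedron (R : realType) (K L : nat) (H : 'M[R]_(K, L))
    (q : 'cV[R]_K) : set 'cV[R]_L :=
  [set zeta | forall k1 : 'I_K, 0 <= (H *m zeta + q) k1 0]%classic.

(* (w, p2, lam, Sz, b, SD, cD, SU, cU) *)
Definition robust_vars (R : realType) (n D s1 s2 : nat) : vectType R :=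
  (R^o * R^o * 'rV[R]_n * 'rV[R]_D * 'rV[R]_D * 'rV[R]_s1 * 'rV[R]_s1
   * 'rV[R]_s2 * 'rV[R]_s2)%type.

(* (v, v1, v2, v3, v4, v5) *)
Definition dual_vars (R : realType) (D s1 s2 K : nat) : vectType R :=
  ('M[R]_(D, K) * 'M[R]_(s1, K) * 'M[R]_(s2, K) * 'M[R]_(s1, K)
   * 'M[R]_(s2, K) * 'M[R]_(D, K))%type.

Definition robust_feasible (R : realType) (n D s1 s2 L : nat)
    (dat : sbm_data R n D s1 s2 L) (k : 'I_n)
    (Z1 : 'I_s1 -> set 'cV[R]_L) (Z2 : 'I_s2 -> set 'cV[R]_L)
    (Zd : 'I_D -> set 'cV[R]_L) (x : robust_vars R n D s1 s2) : Prop :=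
  let: (w, p2, lam, Sz, b, SD, cD, SU, cU) := x in
  let z := perturbed (z0 dat) (zdev dat) in
  let yD := perturbed (yD0 dat) (yDdev dat) in
  let yU := perturbed (yU0 dat) (yUdev dat) in
  [/\ w - p2 - (s1 + s2)%N%:R^-1 * (\sum_r cD 0 r - \sum_r cU 0 r) <= 0
      /\ p2 - D%:R^-1 * (\sum_d b 0 d) <= 1,
      forall d : 'I_D,
        (forall zeta, Zd d zeta ->
           p2 * z zeta d k - \sum_j z zeta d j * lam 0 j - Sz 0 d >= 0) /\
        (forall zeta, Zd d zeta -> z zeta d k * b 0 d - Sz 0 d <= 0),
      forall r : 'I_s1,
        (forall zeta, Z1 r zeta ->
           p2 * yD zeta r k - \sum_j yD zeta r j * lam 0 j + SD 0 r <= 0) /\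
        (forall zeta, Z1 r zeta -> yD zeta r k * cD 0 r - SD 0 r <= 0),
      forall r : 'I_s2,
        (forall zeta, Z2 r zeta ->
           - p2 * yU zeta r k + \sum_j yU zeta r j * lam 0 j + SU 0 r <= 0) /\
        (forall zeta, Z2 r zeta -> yU zeta r k * cU 0 r - SU 0 r <= 0)
    & p2 - \sum_j lam 0 j = 0 /\
      [/\ p2 > 0, forall j, lam 0 j >= 0, forall d, Sz 0 d >= 0,
          forall r, SD 0 r >= 0 & forall r, SU 0 r >= 0]].

Definition robust_sbm (R : realType) (n D s1 s2 L : nat)
    (dat : sbm_data R n D s1 s2 L) (k : 'I_n)
    (Z1 : 'I_s1 -> set 'cV[R]_L) (Z2 : 'I_s2 -> set 'cV[R]_L)
    (Zd : 'I_D -> set 'cV[R]_L) : max_problem R (robust_vars R n D s1 s2) :=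
  MaxProblem
    (fun x => let: (w, _, _, _, _, _, _, _, _) := x in w)
    (robust_feasible dat k Z1 Z2 Zd).

Definition counterpart_feasible (R : realType) (n D s1 s2 L K : nat)
    (dat : sbm_data R n D s1 s2 L) (k : 'I_n)
    (H1 : 'I_s1 -> 'M[R]_(K, L)) (q1 : 'I_s1 -> 'cV[R]_K)
    (H2 : 'I_s2 -> 'M[R]_(K, L)) (q2 : 'I_s2 -> 'cV[R]_K)
    (Hd : 'I_D -> 'M[R]_(K, L)) (qd : 'I_D -> 'cV[R]_K)
    (xv : robust_vars R n D s1 s2 * dual_vars R D s1 s2 K) : Prop :=
  let: ((w, p2, lam, Sz, b, SD, cD, SU, cU), (v, v1, v2, v3, v4, v5)) := xv in
  [/\ [/\ w - p2 - (s1 + s2)%N%:R^-1 * (\sum_r cD 0 r - \sum_r cU 0 r) <= 0,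
          p2 - D%:R^-1 * (\sum_d b 0 d) <= 1
        & p2 - \sum_j lam 0 j = 0],
      [/\ forall d : 'I_D,
            - p2 * z0 dat d k + \sum_j z0 dat d j * lam 0 j + Sz 0 d
              + \sum_(k1 < K) qd d k1 0 * v d k1 <= 0,
          forall (d : 'I_D) (l : 'I_L),
            \sum_(k1 < K) Hd d k1 l * v d k1
              + \sum_j zdev dat l d j * lam 0 j - p2 * zdev dat l d k = 0,
          forall d : 'I_D,
            z0 dat d k * b 0 d - Sz 0 d
              + \sum_(k1 < K) qd d k1 0 * v5 d k1 <= 0
        & forall (d : 'I_D) (l : 'I_L),
            \sum_(k1 < K) Hd d k1 l * v5 d k1 + zdev dat l d k * b 0 d = 0],
      [/\ forall r : 'I_s1,
            p2 * yD0 dat r k - \sum_j yD0 dat r j * lam 0 j + SD 0 r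
              + \sum_(k1 < K) q1 r k1 0 * v1 r k1 <= 0,
          forall (r : 'I_s1) (l : 'I_L),
            \sum_(k1 < K) H1 r k1 l * v1 r k1
              + p2 * yDdev dat l r k - \sum_j yDdev dat l r j * lam 0 j = 0,
          forall r : 'I_s1,
            yD0 dat r k * cD 0 r - SD 0 r
              + \sum_(k1 < K) q1 r k1 0 * v3 r k1 <= 0
        & forall (r : 'I_s1) (l : 'I_L),
            \sum_(k1 < K) H1 r k1 l * v3 r k1 + yDdev dat l r k * cD 0 r = 0],
      [/\ forall r : 'I_s2,
            - p2 * yU0 dat r k + \sum_j yU0 dat r j * lam 0 j + SU 0 r
              + \sum_(k1 < K) q2 r k1 0 * v2 r k1 <= 0,
          forall (r : 'I_s2) (l : 'I_L),
            \sum_(k1 < K) H2 r k1 l * v2 r k1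
              + \sum_j yUdev dat l r j * lam 0 j - p2 * yUdev dat l r k = 0,
          forall r : 'I_s2,
            yU0 dat r k * cU 0 r - SU 0 r
              + \sum_(k1 < K) q2 r k1 0 * v4 r k1 <= 0
        & forall (r : 'I_s2) (l : 'I_L),
            \sum_(k1 < K) H2 r k1 l * v4 r k1 + yUdev dat l r k * cU 0 r = 0]
    & [/\ p2 > 0, forall j, lam 0 j >= 0, forall d, Sz 0 d >= 0,
          forall r, SD 0 r >= 0 & forall r, SU 0 r >= 0] /\
      [/\ forall d k1, v d k1 >= 0 /\ v5 d k1 >= 0,
          forall r k1, v1 r k1 >= 0 /\ v3 r k1 >= 0
        & forall r k1, v2 r k1 >= 0 /\ v4 r k1 >= 0]].

Definition sbm_counterpart (R : realType) (n D s1 s2 L K : nat)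
    (dat : sbm_data R n D s1 s2 L) (k : 'I_n)
    (H1 : 'I_s1 -> 'M[R]_(K, L)) (q1 : 'I_s1 -> 'cV[R]_K)
    (H2 : 'I_s2 -> 'M[R]_(K, L)) (q2 : 'I_s2 -> 'cV[R]_K)
    (Hd : 'I_D -> 'M[R]_(K, L)) (qd : 'I_D -> 'cV[R]_K) :
    max_problem R (robust_vars R n D s1 s2 * dual_vars R D s1 s2 K)%type :=
  MaxProblem
    (fun xv => let: ((w, _, _, _, _, _, _, _, _), _) := xv in w)
    (counterpart_feasible dat k H1 q1 H2 q2 Hd qd).

(* Main.v *)
From HB Require Import structures.
Require Import Defs.
From mathcomp Require Import ring lra zify boolp.

(** Each robust constraint asks that an affine function of the uncertainty
    [zeta], whose coefficients are linear in the decision variables, be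
    nonpositive on a nonempty polyhedron [H zeta + q >= 0]. By the affine form
    of Farkas' lemma ([affine_farkas]) this holds exactly when the function is
    [- v^T (H zeta + q)] plus a nonpositive constant for some [v >= 0]:
    comparing the coefficients of [zeta] gives the equations of the
    counterpart, and comparing the constants its inequalities. The six families
    of robust constraints thus become, one family at a time, the existence of
    the six blocks [v, v1, ..., v5] ([robust_counterpart]), which is the
    equivalence by completion ([robust_feasible_completion]).

    Farkas' lemma itself ([farkas]) is proved by Bartl's induction on the number
    of functionals, which works over an arbitrary vector space and never looks
    at coordinates. The affine form follows by homogenization: nonemptiness
    of the polyhedron is what controls the points at infinity.

    For the second half, all constraints of the counterpart are linear, so each
    is a second-order cone constraint of dimension 0 or an equation. A type
    [linear_system P m p] packages [m] such cones and [p] equations describing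
    a predicate [P], and is closed under conjunction and under quantification
    over an index range; the description of the counterpart, together with the
    exact count of its constraints, is then read off from the shape of
    [counterpart_feasible] ([counterpart_system]). With
    [M = D + s1 + s2] there are [2 + n + 2M + 2MK] variables and
    [4 + n + 3M + 2MK + 2ML] constraints, and both counts are quadratic in
    [n + M + K + L]. *)

Set Implicit Arguments.
Unset Strict Implicit.
Unset Printing Implicit Defensive.

Import Order.TTheory GRing.Theory Num.Theory.
Local Open Scope ring_scope.

(** * Farkas' lemma *)

Lemma scalar_at0 (R : pzRingType) (W : lmodType R) (f : W -> R) :
  scalar f -> f 0 = 0.
Proof.
by move=> lin_f; have := lin_f (-1) 0 0; rewrite scaleN1r oppr0 addr0 mulN1r addNr.
Qed.

(** Bartl's induction. If the first functional [a0] cannot be dropped, there is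
    a point [x0] where the others are nonnegative but [b] is negative; it has
    [a0 x0 < 0], so every point projects along [x0] onto the kernel of [a0].
    The induction hypothesis applies to the functionals composed with this
    projection, and expanding the resulting identity expresses [b] through all
    of them; the sign of the coefficient of [a0] comes from the choice of
    [x0]. *)
Lemma farkas (R : realFieldType) (W : lmodType R) (m : nat)
    (a : 'I_m -> W -> R) (b : W -> R) :
    (forall i, scalar (a i)) -> scalar b ->
    (forall x, (forall i, 0 <= a i x) -> 0 <= b x) ->
  exists2 v : 'I_m -> R, forall i, 0 <= v i & forall x, b x = \sum_i v i * a i x.
Proof.
elim: m => [|m IHm] in a b *; move=> lin_a lin_b pos_b.
  exists (fun=> 0) => // x; rewrite big_ord0; apply/eqP; rewrite eq_le.
  have bN : b (- x) = - b x.
    by have := lin_b (-1) x 0; rewrite (scalar_at0 lin_b) !addr0 scaleN1r mulN1r.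
  rewrite pos_b; last by case.
  by rewrite andbT -oppr_ge0 -bN pos_b //; case.
pose a0 := a ord0; pose a' i := a (lift ord0 i).
have lin_a' i : scalar (a' i) by exact: lin_a.
have lin_a0 : scalar a0 by exact: lin_a.
have pos_split x : 0 <= a0 x -> (forall i, 0 <= a' i x) -> 0 <= b x.
  move=> a0x a'x; apply: pos_b => i.
  by have [j ->|->] := unliftP ord0 i; [exact: a'x | exact: a0x].
pose extend c (v : 'I_m -> R) i := if unlift ord0 i is Some j then v j else c.
have extendE c v x :
    \sum_i extend c v i * a i x = c * a0 x + \sum_i v i * a' i x.
  rewrite big_ord_recl /extend unlift_none; congr (_ + _).
  by apply: eq_bigr => i _; rewrite liftK.
have extend_ge0 c v : 0 <= c -> (forall i, 0 <= v i) -> forall i, 0 <= extend c v i.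
  by move=> c0 v0 i; rewrite /extend; case: unlift.
have [pos'|] := pselect (forall x, (forall i, 0 <= a' i x) -> 0 <= b x).
  have [v v_ge0 bE] := IHm a' b lin_a' lin_b pos'.
  by exists (extend 0 v) => [|x]; [exact: extend_ge0 | rewrite extendE mul0r add0r].
move=> /existsNP[x0 /not_implyP[a'x0 /negP]]; rewrite -ltNge => bx0.
have a0x0 : a0 x0 < 0.
  rewrite ltNge; apply/negP => a0x0.
  by move: bx0; rewrite ltNge (pos_split _ a0x0 a'x0).
(* [p] is the projection onto the kernel of [a0] along [x0]. *)
pose t x := - a0 x / a0 x0.
pose p x := t x *: x0 + x.
have lin_p f : scalar f -> scalar (fun x => f (p x)).
  by move=> lin_f c x y; rewrite /p !lin_f /t lin_a0; lra.
have a0p x : a0 (p x) = 0 by rewrite lin_a0 /t divfK ?lt_eqF // addNr.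
have [|v v_ge0 bE] := IHm (fun i x => a' i (p x)) (fun x => b (p x))
    (fun i => lin_p _ (lin_a' i)) (lin_p _ lin_b).
  by move=> x a'px; apply: pos_split a'px; rewrite a0p.
pose s0 := \sum_i v i * a' i x0.
exists (extend ((b x0 - s0) / a0 x0) v).
  apply: extend_ge0 => //; rewrite ler_ndivlMr // mul0r subr_le0.
  by rewrite (le_trans (ltW bx0)) // sumr_ge0 // => j _; rewrite mulr_ge0.
move=> x; rewrite extendE.
have := bE x; rewrite /p lin_b.
under eq_bigr => i _ do rewrite lin_a' mulrDr mulrCA.
rewrite big_split /= -mulr_sumr -/s0 => eb.
have -> : b x = \sum_i v i * a' i x - t x * (b x0 - s0) by lra.
by rewrite /t; field; rewrite lt_eqF.
Qed.

(** The homogeneous lemma is applied on pairs [(zeta, t)] to the functionals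
    [H zeta + t q] and [t]. A pair with [t > 0] rescales to the polyhedron; one
    with [t = 0] is a recession direction, and following it from a point of
    the polyhedron shows that the affine function cannot increase along it.
    This is the only use of nonemptiness: for an empty polyhedron the
    left-hand side holds vacuously, whatever [alpha] and [beta]. *)
Lemma affine_farkas (R : realType) (K L : nat) (H : 'M[R]_(K, L))
    (q : 'cV[R]_K) (alpha : R) (beta : 'I_L -> R) :
    (polyhedron H q !=set0)%classic ->
  (forall zeta, polyhedron H q zeta ->
     alpha + \sum_l zeta l 0 * beta l <= 0) <->
  exists v : 'I_K -> R,
    [/\ forall k, 0 <= v k, alpha + \sum_k q k 0 * v k <= 0
      & forall l, \sum_k H k l * v k + beta l = 0].
Proof.
move=> [zeta0 Hzeta0]; split; last first.
  move=> [v [v_ge0 nom dev]] zeta Hzeta; apply: le_trans nom.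
  rewrite lerD2l -subr_ge0.
  have -> : \sum_k q k 0 * v k - \sum_l zeta l 0 * beta l =
            \sum_k v k * (H *m zeta + q) k 0.
    under [RHS]eq_bigr => k _.
      rewrite mxE mulrDr addrC (mulrC _ (q k 0)) [(_ *m _) _ _]mxE mulr_sumr.
      over.
    rewrite big_split /= exchange_big -sumrN; congr (_ + _).
    apply: eq_bigr => l _.
    have /eqP := dev l; rewrite addrC addr_eq0 => /eqP ->.
    rewrite mulrN opprK mulr_sumr; apply: eq_bigr => k _; ring.
  by apply: sumr_ge0 => k _; rewrite mulr_ge0.
move=> robust.
pose dot (zeta : 'cV[R]_L) := \sum_l zeta l 0 * beta l.
have dot_lin : scalar dot.
  move=> c x y; rewrite /dot mulr_sumr -big_split; apply: eq_bigr => l _ /=.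
  by rewrite !mxE; ring.
(* Index 0 carries the constraint t >= 0, index k + 1 the k-th row. *)
pose a (i : 'I_K.+1) (x : 'cV[R]_L * R^o) : R :=
  if unlift ord0 i is Some k then (H *m x.1) k 0 + x.2 * q k 0 else x.2.
pose b (x : 'cV[R]_L * R^o) : R := - (dot x.1 + x.2 * alpha).
have lin_a i : scalar (a i).
  move=> c x y; rewrite /a; case: unlift => [k|//] /=.
  by rewrite linearD linearZ !mxE /GRing.scale /=; ring.
have lin_b : scalar b.
  by move=> c x y; rewrite /b /= dot_lin /GRing.scale /=; ring.
have [x ax|v v_ge0 bE] := farkas lin_a lin_b.
  have t_ge0 : 0 <= x.2 by have := ax ord0; rewrite /a unlift_none.
  have Hx k : 0 <= (H *m x.1) k 0 + x.2 * q k 0.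
    by have := ax (lift ord0 k); rewrite /a liftK.
  rewrite /b oppr_ge0; have [t_gt0|t_le0] := ltP 0 x.2.
    have := robust (x.2^-1 *: x.1 + 0); rewrite -/(dot _) dot_lin.
    rewrite (scalar_at0 dot_lin) !addr0 => h.
    rewrite -(pmulr_rle0 _ (_ : 0 < x.2^-1)) ?invr_gt0 //.
    rewrite mulrDr mulKf ?gt_eqF // addrC; apply: h => k.
    rewrite -scalemxAr !mxE -(pmulr_rge0 _ t_gt0) mulrDr mulrA divff ?gt_eqF //.
    by rewrite mul1r; have := Hx k; rewrite mxE.
  have t0 : x.2 = 0 by apply/eqP; rewrite eq_le t_le0.
  rewrite t0 mul0r addr0 leNgt; apply/negP => dx.
  (* The point zeta0 + s x.1 stays in the polyhedron for all s >= 0; this s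
     makes the affine function at least 1 there. *)
  pose s := (`|alpha + dot zeta0| + 1) / dot x.1.
  have s_ge0 : 0 <= s by rewrite divr_ge0 ?(ltW dx) // addr_ge0.
  have := robust (s *: x.1 + zeta0); rewrite -/(dot _) dot_lin divfK ?gt_eqF //.
  have -> : alpha + (`|alpha + dot zeta0| + 1 + dot zeta0) =
            alpha + dot zeta0 + `|alpha + dot zeta0| + 1 by ring.
  have abs := ler_norm (- (alpha + dot zeta0)); rewrite normrN in abs.
  move=> h; suff : alpha + dot zeta0 + `|alpha + dot zeta0| + 1 <= 0 by lra.
  apply: h => k.
  have -> : (H *m (s *: x.1 + zeta0) + q) k 0 =
            s * (H *m x.1) k 0 + (H *m zeta0 + q) k 0.
    by rewrite mulmxDr -scalemxAr -addrA [LHS]mxE; congr (_ + _); rewrite mxE.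
  apply: addr_ge0; last exact: Hzeta0.
  by apply: mulr_ge0 => //; have := Hx k; rewrite t0 mul0r addr0.
have aE x : \sum_i v i * a i x =
    v ord0 * x.2 + \sum_k v (lift ord0 k) * ((H *m x.1) k 0 + x.2 * q k 0).
  rewrite big_ord_recl {1}/a unlift_none; congr (_ + _).
  by apply: eq_bigr => k _; rewrite /a liftK.
(* Evaluating the identity at (0, 1) compares the constants, and at (e_l, 0)
   the coefficients of the l-th uncertainty. *)
exists (fun k => v (lift ord0 k)); split=> // [|l].
  have := bE (0, 1); rewrite aE /b /= (scalar_at0 dot_lin) mulmx0.
  under eq_bigr => k _ do rewrite mxE add0r mul1r mulrC.
  by have := v_ge0 ord0; lra.
have := bE (delta_mx l 0, 0); rewrite aE /b /= mulr0 mul0r add0r addr0.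
have -> : dot (delta_mx l 0) = beta l.
  rewrite /dot (bigD1 l) //= mxE !eqxx mul1r big1 ?addr0 // => j /negPf jl.
  by rewrite mxE jl mul0r.
under eq_bigr => k _ do rewrite -colE mxE mul0r addr0 mulrC.
by move=> <-; rewrite addNr.
Qed.

(** * Robust counterparts of the constraint families *)

Definition dual_certificate (R : realType) (m K L : nat)
    (H : 'I_m -> 'M[R]_(K, L)) (q : 'I_m -> 'cV[R]_K)
    (alpha : 'I_m -> R) (beta : 'I_L -> 'I_m -> R) (v : 'M[R]_(m, K)) : Prop :=
  [/\ forall i k, 0 <= v i k,
      forall i, alpha i + \sum_k q i k 0 * v i k <= 0
    & forall i l, \sum_k H i k l * v i k + beta l i = 0].

(** The certificates of the individual rows are chosen independently, so they
    assemble into one matrix. *)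
Lemma robust_counterpart (R : realType) (m K L : nat)
    (H : 'I_m -> 'M[R]_(K, L)) (q : 'I_m -> 'cV[R]_K)
    (alpha : 'I_m -> R) (beta : 'I_L -> 'I_m -> R) :
    (forall i, (polyhedron (H i) (q i) !=set0)%classic) ->
  (forall i zeta, polyhedron (H i) (q i) zeta ->
     alpha i + \sum_l zeta l 0 * beta l i <= 0) <->
  exists v, dual_certificate H q alpha beta v.
Proof.
move=> nonempty; split.
  move=> robust.
  have /choice[v vP] i : exists v : 'I_K -> R,
      [/\ forall k, 0 <= v k, alpha i + \sum_k q i k 0 * v k <= 0
        & forall l, \sum_k H i k l * v k + beta l i = 0].
    by apply/(affine_farkas _ (beta ^~ i) (nonempty i)) => zeta; exact: robust.
  exists (\matrix_(i, k) v i k).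
  split=> [i k|i|i l]; have [v_ge0 nom dev] := vP i; first by rewrite mxE.
    by under eq_bigr => k _ do rewrite mxE.
  by under eq_bigr => k _ do rewrite mxE.
move=> [v [v_ge0 nom dev]] i; apply/(affine_farkas _ (beta ^~ i) (nonempty i)).
by exists (v i).
Qed.

Lemma perturbed_single (R : realType) (m n L : nat) (a0 : 'M[R]_(m, n))
    (adev : 'I_L -> 'M[R]_(m, n)) zeta i k (c S : R) :
  perturbed a0 adev zeta i k * c - S =
  a0 i k * c - S + \sum_l zeta l 0 * (adev l i k * c).
Proof.
rewrite /perturbed mulrDl mulr_suml addrAC; congr (_ + _).
by apply: eq_bigr => l _; rewrite mulrA.
Qed.

Lemma perturbed_comb (R : realType) (m n L : nat) (a0 : 'M[R]_(m, n))
    (adev : 'I_L -> 'M[R]_(m, n)) zeta i k (p : R) (lam : 'rV[R]_n) :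
  p * perturbed a0 adev zeta i k - \sum_j perturbed a0 adev zeta i j * lam 0 j =
  p * a0 i k - \sum_j a0 i j * lam 0 j +
  \sum_l zeta l 0 * (p * adev l i k - \sum_j adev l i j * lam 0 j).
Proof.
have -> : \sum_j perturbed a0 adev zeta i j * lam 0 j =
    \sum_j a0 i j * lam 0 j + \sum_l zeta l 0 * \sum_j adev l i j * lam 0 j.
  under eq_bigr => j _ do rewrite mulrDl mulr_suml.
  rewrite big_split exchange_big; congr (_ + _); apply: eq_bigr => l _.
  by rewrite mulr_sumr; apply: eq_bigr => j _; rewrite mulrA.
rewrite /perturbed mulrDr mulr_sumr opprD addrACA -sumrB; congr (_ + _).
by apply: eq_bigr => l _; rewrite mulrBr mulrCA.
Qed.

Lemma robust_slack_bound (R : realType) (m n K L : nat)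
    (H : 'I_m -> 'M[R]_(K, L)) (q : 'I_m -> 'cV[R]_K) (a0 : 'M[R]_(m, n))
    (adev : 'I_L -> 'M[R]_(m, n)) (k : 'I_n) (c S : 'rV[R]_m) :
    (forall i, (polyhedron (H i) (q i) !=set0)%classic) ->
  (forall i zeta, polyhedron (H i) (q i) zeta ->
     perturbed a0 adev zeta i k * c 0 i - S 0 i <= 0) <->
  exists v, dual_certificate H q (fun i => a0 i k * c 0 i - S 0 i)
    (fun l i => adev l i k * c 0 i) v.
Proof.
move=> nonempty; rewrite -robust_counterpart //.
by split=> h i zeta Zz; have := h i zeta Zz; rewrite perturbed_single.
Qed.

(** For intermediates and undesirable outputs the slack is at most the excess of
    the scaled unit [k] over the composite unit; for desirable outputs
    ([robust_slack_below]) at most its shortfall. *)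
Lemma robust_slack_above (R : realType) (m n K L : nat)
    (H : 'I_m -> 'M[R]_(K, L)) (q : 'I_m -> 'cV[R]_K) (a0 : 'M[R]_(m, n))
    (adev : 'I_L -> 'M[R]_(m, n)) (k : 'I_n) (p : R) (lam : 'rV[R]_n)
    (S : 'rV[R]_m) :
    (forall i, (polyhedron (H i) (q i) !=set0)%classic) ->
  (forall i zeta, polyhedron (H i) (q i) zeta ->
     - p * perturbed a0 adev zeta i k
       + \sum_j perturbed a0 adev zeta i j * lam 0 j + S 0 i <= 0) <->
  exists v, dual_certificate H q
    (fun i => - p * a0 i k + \sum_j a0 i j * lam 0 j + S 0 i)
    (fun l i => \sum_j adev l i j * lam 0 j - p * adev l i k) v.
Proof.
move=> nonempty; rewrite -robust_counterpart //.
have E i zeta : - p * perturbed a0 adev zeta i k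
       + \sum_j perturbed a0 adev zeta i j * lam 0 j + S 0 i =
    - p * a0 i k + \sum_j a0 i j * lam 0 j + S 0 i +
    \sum_l zeta l 0 * (\sum_j adev l i j * lam 0 j - p * adev l i k).
  have := perturbed_comb a0 adev zeta i k p lam.
  under [X in _ = _ + X -> _]eq_bigr => l _ do rewrite -opprB mulrN.
  by rewrite sumrN; lra.
by split=> h i zeta Zz; have := h i zeta Zz; rewrite E.
Qed.

Lemma robust_slack_below (R : realType) (m n K L : nat)
    (H : 'I_m -> 'M[R]_(K, L)) (q : 'I_m -> 'cV[R]_K) (a0 : 'M[R]_(m, n))
    (adev : 'I_L -> 'M[R]_(m, n)) (k : 'I_n) (p : R) (lam : 'rV[R]_n)
    (S : 'rV[R]_m) :
    (forall i, (polyhedron (H i) (q i) !=set0)%classic) ->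
  (forall i zeta, polyhedron (H i) (q i) zeta ->
     p * perturbed a0 adev zeta i k
       - \sum_j perturbed a0 adev zeta i j * lam 0 j + S 0 i <= 0) <->
  exists v, dual_certificate H q
    (fun i => p * a0 i k - \sum_j a0 i j * lam 0 j + S 0 i)
    (fun l i => p * adev l i k - \sum_j adev l i j * lam 0 j) v.
Proof.
move=> nonempty; rewrite -robust_counterpart //.
by split=> h i zeta Zz; have := h i zeta Zz; rewrite perturbed_comb addrAC.
Qed.

(** The auxiliary blocks occur in disjoint constraints, so they can be produced
    and used one family at a time. *)
Lemma robust_feasible_completion (R : realType) (n D s1 s2 L K : nat) (k : 'I_n)
    (dat : sbm_data R n D s1 s2 L)
    (H1 : 'I_s1 -> 'M[R]_(K, L)) (q1 : 'I_s1 -> 'cV[R]_K)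
    (H2 : 'I_s2 -> 'M[R]_(K, L)) (q2 : 'I_s2 -> 'cV[R]_K)
    (Hd : 'I_D -> 'M[R]_(K, L)) (qd : 'I_D -> 'cV[R]_K)
    (Z1_nonempty : forall r, (polyhedron (H1 r) (q1 r) !=set0)%classic)
    (Z2_nonempty : forall r, (polyhedron (H2 r) (q2 r) !=set0)%classic)
    (Zd_nonempty : forall d, (polyhedron (Hd d) (qd d) !=set0)%classic)
    (x : robust_vars R n D s1 s2) :
  robust_feasible dat k
       (fun r => polyhedron (H1 r) (q1 r))
       (fun r => polyhedron (H2 r) (q2 r))
       (fun d => polyhedron (Hd d) (qd d)) x <->
  exists a, counterpart_feasible dat k H1 q1 H2 q2 Hd qd (x, a).
Proof.
move: x => [[[[[[[[w p] lam] Sz] b] SD] cD] SU] cU].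
have [zv zv'] := robust_slack_above (z0 dat) (zdev dat) k p lam Sz Zd_nonempty.
have [yv1 yv1'] := robust_slack_below (yD0 dat) (yDdev dat) k p lam SD Z1_nonempty.
have [yv2 yv2'] := robust_slack_above (yU0 dat) (yUdev dat) k p lam SU Z2_nonempty.
have [yv3 yv3'] := robust_slack_bound (yD0 dat) (yDdev dat) k cD SD Z1_nonempty.
have [yv4 yv4'] := robust_slack_bound (yU0 dat) (yUdev dat) k cU SU Z2_nonempty.
have [zv5 zv5'] := robust_slack_bound (z0 dat) (zdev dat) k b Sz Zd_nonempty.
split.
  move=> [[hw hp] hd h1 h2 [hs signs]].
  have [|v [v_ge0 nom dev]] := zv.
    by move=> d zeta /(proj1 (hd d)); lra.
  have [|v1 [v1_ge0 nom1 dev1]] := yv1; first by move=> r; exact: (h1 r).1.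
  have [|v2 [v2_ge0 nom2 dev2]] := yv2; first by move=> r; exact: (h2 r).1.
  have [|v3 [v3_ge0 nom3 dev3]] := yv3; first by move=> r; exact: (h1 r).2.
  have [|v4 [v4_ge0 nom4 dev4]] := yv4; first by move=> r; exact: (h2 r).2.
  have [|v5 [v5_ge0 nom5 dev5]] := zv5; first by move=> d; exact: (hd d).2.
  exists (v, v1, v2, v3, v4, v5); split=> //; split=> // *; by rewrite -addrA.
move=> [[[[[[v v1] v2] v3] v4] v5]].
move=> [[hw hp hs] [nom dev nom5 dev5] [nom1 dev1 nom3 dev3]].
move=> [nom2 dev2 nom4 dev4] [signs [vv5_ge0 v1v3_ge0 v2v4_ge0]].
have {}zv' := zv' (ex_intro _ v _); have {}zv5' := zv5' (ex_intro _ v5 _).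
have {}yv1' := yv1' (ex_intro _ v1 _); have {}yv2' := yv2' (ex_intro _ v2 _).
have {}yv3' := yv3' (ex_intro _ v3 _); have {}yv4' := yv4' (ex_intro _ v4 _).
split=> // [d|r|r]; split=> zeta Zz.
(* The model states this constraint with the opposite sign. *)
- suff: - p * perturbed (z0 dat) (zdev dat) zeta d k
     + \sum_j perturbed (z0 dat) (zdev dat) zeta d j * lam 0 j + Sz 0 d <= 0 by lra.
  apply: zv' => //; split=> // [i j|i l]; first exact: (vv5_ge0 i j).1.
  by rewrite addrA.
- by apply: zv5' => //; split=> // i j; exact: (vv5_ge0 i j).2.
- apply: yv1' => //; split=> // [i j|i l]; first exact: (v1v3_ge0 i j).1.
  by rewrite addrA.
- by apply: yv3' => //; split=> // i j; exact: (v1v3_ge0 i j).2.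
- apply: yv2' => //; split=> // [i j|i l]; first exact: (v2v4_ge0 i j).1.
  by rewrite addrA.
- by apply: yv4' => //; split=> // i j; exact: (v2v4_ge0 i j).2.
Qed.

(** * Linear systems as second-order cone programs *)

Section ScalarForms.
Variables (R : comPzRingType) (W : lmodType R).
Implicit Types f g : W -> R.

Lemma scalar_add f g : scalar f -> scalar g -> scalar (fun x => f x + g x).
Proof. by move=> lin_f lin_g c x y; rewrite lin_f lin_g; ring. Qed.

Lemma scalar_opp f : scalar f -> scalar (fun x => - f x).
Proof. by move=> lin_f c x y; rewrite lin_f; ring. Qed.

Lemma scalar_mull c f : scalar f -> scalar (fun x => c * f x).
Proof. by move=> lin_f a x y; rewrite lin_f; ring. Qed.

Lemma scalar_mulr c f : scalar f -> scalar (fun x => f x * c).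
Proof. by move=> lin_f a x y; rewrite lin_f; ring. Qed.

Lemma scalar_sum (I : finType) (f : I -> W -> R) :
  (forall i, scalar (f i)) -> scalar (fun x => \sum_i f i x).
Proof.
move=> lin_f a x y; rewrite mulr_sumr -big_split.
by apply: eq_bigr => i _; rewrite lin_f.
Qed.

End ScalarForms.

Definition hom_of (R : realType) (V : vectType R) (f : V -> R) : 'Hom(V, R^o) :=
  linfun (f : V -> R^o).

Lemma hom_ofE (R : realType) (V : vectType R) (f : V -> R) :
  scalar f -> hom_of f =1 f.
Proof.
move=> lin_f x.
pose f' : {linear V -> R^o} := HB.pack (f : V -> R^o)
  (GRing.isLinear.Build R V R^o *:%R (f : V -> R^o) lin_f).
exact: (lfunE f').
Qed.

(** Living in [Type] rather than in [Prop] lets [system_forall] collect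
    the systems of a whole index range without a choice argument. The counts
    [m] and [p] are parameters so that the size of a composite system is known
    from its construction. *)
Record linear_system (R : realType) (V : vectType R) (P : V -> Prop)
    (m p : nat) := LinearSystem {
  ls_cone : 'I_m -> soc_constraint V;
  ls_F : 'I_p -> 'Hom(V, R^o);
  ls_g : 'I_p -> R;
  ls_dim : forall i, soc_dim (ls_cone i) = 0%N;
  ls_holds : forall x, P x <->
    (forall i, soc_holds (ls_cone i) x) /\ (forall i, ls_F i x = ls_g i) }.

Section LinearSystems.
Variables (R : realType) (V : vectType R).
Implicit Types (P Q : V -> Prop) (f : V -> R).

(** Arbitrary finite index types make concatenation a sum type and indexing a
    product type, without arithmetic on ordinals. *)
Lemma system_of_fintypes P (I J : finType) (cone : I -> soc_constraint V)
    (F : J -> 'Hom(V, R^o)) (g : J -> R) :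
    (forall i, soc_dim (cone i) = 0%N) ->
    (forall x, P x <->
      (forall i, soc_holds (cone i) x) /\ (forall j, F j x = g j)) ->
  linear_system P #|I| #|J|.
Proof.
move=> dim0 PE.
apply: (@LinearSystem _ _ _ _ _ (fun i => cone (enum_val i))
  (fun j => F (enum_val j)) (fun j => g (enum_val j))) => // x.
rewrite PE; split=> -[hc he]; split=> // i.
  by have := hc (enum_rank i); rewrite enum_rankK.
by have := he (enum_rank i); rewrite enum_rankK.
Qed.

Lemma system_ext P Q m p :
  (forall x, P x <-> Q x) -> linear_system P m p -> linear_system Q m p.
Proof. by move=> PQ [c F g dim0 PE]; exists c F g => // x; rewrite -PQ PE. Qed.

Lemma system_and P Q m m' p p' :
  linear_system P m p -> linear_system Q m' p' ->
  linear_system (fun x => P x /\ Q x) (m + m') (p + p').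
Proof.
move=> [c F g dim0 PE] [c' F' g' dim0' QE].
have := @system_of_fintypes (fun x => P x /\ Q x)
  ('I_m + 'I_m')%type ('I_p + 'I_p')%type
  (fun i => match i with inl i => c i | inr i => c' i end)
  (fun j => match j with inl j => F j | inr j => F' j end)
  (fun j => match j with inl j => g j | inr j => g' j end).
rewrite !card_sum !card_ord; apply; first by case.
move=> x; rewrite PE QE; split.
  by move=> [[? ?] [? ?]]; split; case.
move=> [hc he]; split; split=> i.
- exact: (hc (inl i)).
- exact: (he (inl i)).
- exact: (hc (inr i)).
- exact: (he (inr i)).
Qed.

Lemma system_and3 P1 P2 P3 m1 m2 m3 p1 p2 p3 :
  linear_system P1 m1 p1 -> linear_system P2 m2 p2 -> linear_system P3 m3 p3 ->
  linear_system (fun x => [/\ P1 x, P2 x & P3 x])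
    (m1 + m2 + m3) (p1 + p2 + p3).
Proof.
move=> S1 S2 S3; apply: system_ext (system_and (system_and S1 S2) S3) => x.
by split=> [[[]]|[]].
Qed.

Lemma system_and4 P1 P2 P3 P4 m1 m2 m3 m4 p1 p2 p3 p4 :
  linear_system P1 m1 p1 -> linear_system P2 m2 p2 ->
  linear_system P3 m3 p3 -> linear_system P4 m4 p4 ->
  linear_system (fun x => [/\ P1 x, P2 x, P3 x & P4 x])
    (m1 + m2 + m3 + m4) (p1 + p2 + p3 + p4).
Proof.
move=> S1 S2 S3 S4; apply: system_ext (system_and (system_and3 S1 S2 S3) S4) => x.
by split=> [[[]]|[]].
Qed.

Lemma system_and5 P1 P2 P3 P4 P5 m1 m2 m3 m4 m5 p1 p2 p3 p4 p5 :
  linear_system P1 m1 p1 -> linear_system P2 m2 p2 ->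
  linear_system P3 m3 p3 -> linear_system P4 m4 p4 ->
  linear_system P5 m5 p5 ->
  linear_system (fun x => [/\ P1 x, P2 x, P3 x, P4 x & P5 x])
    (m1 + m2 + m3 + m4 + m5) (p1 + p2 + p3 + p4 + p5).
Proof.
move=> S1 S2 S3 S4 S5.
apply: system_ext (system_and (system_and4 S1 S2 S3 S4) S5) => x.
by split=> [[[]]|[]].
Qed.

Lemma system_forall (n : nat) (P : 'I_n -> V -> Prop) m p :
  (forall i, linear_system (P i) m p) ->
  linear_system (fun x => forall i, P i x) (n * m) (n * p).
Proof.
move=> S.
have := @system_of_fintypes (fun x => forall i, P i x)
  ('I_n * 'I_m)%type ('I_n * 'I_p)%type
  (fun ij => ls_cone (S ij.1) ij.2)
  (fun ij => ls_F (S ij.1) ij.2) (fun ij => ls_g (S ij.1) ij.2).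
rewrite !card_prod !card_ord; apply; first by move=> i; exact: ls_dim.
move=> x; split=> [Px | [hc he] i].
  by split=> -[i j]; have [hc he] := (ls_holds (S i) x).1 (Px i).
by apply/(ls_holds (S i)); split=> j; [exact: (hc (i, j)) | exact: (he (i, j))].
Qed.

(** In dimension 0 the norm vanishes, so the cone constraint only says that its
    affine right-hand side is nonnegative, or positive. *)
Definition half_space f (c : R) (strict : bool) : soc_constraint V :=
  @SocConstraint R V 0 0 0 (hom_of f) c strict.

Lemma half_spaceE f c strict x : scalar f ->
  soc_holds (half_space f c strict) x <-> 0 < f x + c ?<= if ~~ strict.
Proof.
move=> lin_f; rewrite /soc_holds /l2norm big_ord0 sqrtr0 /=.
by rewrite hom_ofE.
Qed.

Lemma system_half_space P f c strict : scalar f ->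
  (forall x, P x <-> 0 < f x + c ?<= if ~~ strict) -> linear_system P 1 0.
Proof.
move=> lin_f PE.
apply: (@LinearSystem _ _ _ _ _ (fun=> half_space f c strict)
  (fun=> 0) (fun=> 0)) => // x.
by rewrite PE -half_spaceE //; split=> [h|[h _]]; [split=> // -[] | exact: h ord0].
Qed.

Lemma system_le f c : scalar f -> linear_system (fun x => f x <= c) 1 0.
Proof.
move=> lin_f; have lin_Nf := scalar_opp lin_f.
apply: (system_half_space (c := c) (strict := false) lin_Nf).
by move=> x /=; rewrite addrC subr_ge0.
Qed.

Lemma system_ge0 f : scalar f -> linear_system (fun x => 0 <= f x) 1 0.
Proof.
move=> lin_f; apply: (system_half_space (c := 0) (strict := false) lin_f).
by move=> x /=; rewrite addr0.
Qed.

Lemma system_gt0 f : scalar f -> linear_system (fun x => 0 < f x) 1 0.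
Proof.
move=> lin_f; apply: (system_half_space (c := 0) (strict := true) lin_f).
by move=> x /=; rewrite addr0.
Qed.

Lemma system_eq f c : scalar f -> linear_system (fun x => f x = c) 0 1.
Proof.
move=> lin_f.
(* The index type of the cones is empty; the half-space is a placeholder. *)
apply: (@LinearSystem _ _ _ _ _ (fun=> half_space f 0 false)
  (fun=> hom_of f) (fun=> c)) => // x; rewrite hom_ofE //.
by split=> [h|[_ h]]; [split=> // -[] | exact: h ord0].
Qed.

Lemma socp_of_system P f m p : linear_system P m p -> scalar f ->
  exists C : socp V,
    same_problem (socp_problem C) (MaxProblem f P) /\
    socp_size C = ((\dim {: V}).+1 * (1 + p + m))%N.
Proof.
move=> [c F g dim0 PE] lin_f; exists (Socp (hom_of f) c F g).
split; first by split=> x /=; [rewrite PE | rewrite hom_ofE].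
rewrite /socp_size /= (eq_bigr (fun=> 1%N)) => [|i _]; last by rewrite dim0.
by rewrite sum1_card card_ord.
Qed.

End LinearSystems.

(** * The counterpart as a second-order cone program *)

Lemma scalar_coord (R : comPzRingType) (W : lmodType R) (m n : nat)
    (A : W -> 'M[R]_(m, n)) (i : 'I_m) (j : 'I_n) :
  linear A -> scalar (fun x => A x i j).
Proof. by move=> lin_A c x y; rewrite lin_A !mxE. Qed.

Ltac prove_scalar := repeat first
  [ assumption | apply: scalar_sum => ? | apply: scalar_coord; assumption
  | apply: scalar_opp | apply: scalar_add
  | apply: scalar_mull | apply: scalar_mulr ].

Ltac build_system := repeat first
  [ apply: system_forall => ?
  | apply: system_and | apply: system_and3 | apply: system_and4
  | apply: system_and5 | apply: system_le | apply: system_ge0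
  | apply: system_gt0 | apply: system_eq ].

Lemma system_size (R : realType) (V : vectType R) (P : V -> Prop) m p m' p' :
  linear_system P m p -> m = m' -> p = p' -> linear_system P m' p'.
Proof. by move=> S <- <-. Qed.

(** The variables are arbitrary linear functions on an abstract space [V]
    instead of projections of the concrete product: this keeps the tuple out of
    the linearity goals, which would otherwise unfold its vector space
    structure. *)
Lemma counterpart_system (R : realType) (n D s1 s2 L K : nat)
    (dat : sbm_data R n D s1 s2 L) (k : 'I_n)
    (H1 : 'I_s1 -> 'M[R]_(K, L)) (q1 : 'I_s1 -> 'cV[R]_K)
    (H2 : 'I_s2 -> 'M[R]_(K, L)) (q2 : 'I_s2 -> 'cV[R]_K)
    (Hd : 'I_D -> 'M[R]_(K, L)) (qd : 'I_D -> 'cV[R]_K)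
    (V : vectType R) (w p2 : V -> R) (lam : V -> 'rV[R]_n)
    (Sz b : V -> 'rV[R]_D) (SD cD : V -> 'rV[R]_s1) (SU cU : V -> 'rV[R]_s2)
    (v v5 : V -> 'M[R]_(D, K)) (v1 v3 : V -> 'M[R]_(s1, K))
    (v2 v4 : V -> 'M[R]_(s2, K)) :
    scalar w -> scalar p2 -> linear lam -> linear Sz -> linear b ->
    linear SD -> linear cD -> linear SU -> linear cU ->
    linear v -> linear v1 -> linear v2 -> linear v3 -> linear v4 -> linear v5 ->
  linear_system (fun x => counterpart_feasible dat k H1 q1 H2 q2 Hd qd
    ((w x, p2 x, lam x, Sz x, b x, SD x, cD x, SU x, cU x),
     (v x, v1 x, v2 x, v3 x, v4 x, v5 x)))
    (3 + n + 3 * (D + s1 + s2) + 2 * (D + s1 + s2) * K)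
    (1 + 2 * (D + s1 + s2) * L).
Proof.
(* The tactics determine the two counts, compared at the end. *)
move=> *; apply: system_size.
  rewrite /counterpart_feasible; build_system.
all: try prove_scalar.
all: ring.
Qed.

Lemma dim_vars (R : realType) (n D s1 s2 K : nat) :
  \dim {: (robust_vars R n D s1 s2 * dual_vars R D s1 s2 K)%type} =
  (2 + n + 2 * (D + s1 + s2) + 2 * (D + s1 + s2) * K)%N.
Proof. by rewrite dimvf; cbn -[muln addn]; ring. Qed.

(** Over abstract factors these hold by computation; over the concrete factors
    the same computation would unfold the matrix structures. *)
Lemma linear_projections (R : pzRingType)
    (A1 A2 A3 A4 A5 A6 A7 A8 A9 B1 B2 B3 B4 B5 B6 : lmodType R) :
  let V := (A1 * A2 * A3 * A4 * A5 * A6 * A7 * A8 * A9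
            * (B1 * B2 * B3 * B4 * B5 * B6))%type in
  [/\ linear (fun x : V => x.1.1.1.1.1.1.1.1.1),
      linear (fun x : V => x.1.1.1.1.1.1.1.1.2),
      linear (fun x : V => x.1.1.1.1.1.1.1.2),
      linear (fun x : V => x.1.1.1.1.1.1.2)
    & linear (fun x : V => x.1.1.1.1.1.2)] /\
  [/\ linear (fun x : V => x.1.1.1.1.2),
      linear (fun x : V => x.1.1.1.2),
      linear (fun x : V => x.1.1.2)
    & linear (fun x : V => x.1.2)] /\
  [/\ linear (fun x : V => x.2.1.1.1.1.1),
      linear (fun x : V => x.2.1.1.1.1.2),
      linear (fun x : V => x.2.1.1.1.2)
    & [/\ linear (fun x : V => x.2.1.1.2),
          linear (fun x : V => x.2.1.2)
        & linear (fun x : V => x.2.2)]].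
Proof. by []. Qed.

Lemma counterpart_socp (R : realType) (n D s1 s2 L K : nat) (k : 'I_n)
    (dat : sbm_data R n D s1 s2 L)
    (H1 : 'I_s1 -> 'M[R]_(K, L)) (q1 : 'I_s1 -> 'cV[R]_K)
    (H2 : 'I_s2 -> 'M[R]_(K, L)) (q2 : 'I_s2 -> 'cV[R]_K)
    (Hd : 'I_D -> 'M[R]_(K, L)) (qd : 'I_D -> 'cV[R]_K) :
  exists C : socp (robust_vars R n D s1 s2 * dual_vars R D s1 s2 K)%type,
    same_problem (socp_problem C) (sbm_counterpart dat k H1 q1 H2 q2 Hd qd) /\
    (socp_size C <= 100 * (n + D + s1 + s2 + K + L) ^ 4)%N.
Proof.
have [[lw lp llam lSz lb] [[lSD lcD lSU lcU] [lv lv1 lv2 [lv3 lv4 lv5]]]] :=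
  linear_projections R^o R^o 'rV[R]_n 'rV[R]_D 'rV[R]_D 'rV[R]_s1 'rV[R]_s1
    'rV[R]_s2 'rV[R]_s2 'M[R]_(D, K) 'M[R]_(s1, K) 'M[R]_(s2, K)
    'M[R]_(s1, K) 'M[R]_(s2, K) 'M[R]_(D, K).
have S := counterpart_system
  (V := (robust_vars R n D s1 s2 * dual_vars R D s1 s2 K)%type)
  dat k H1 q1 H2 q2 Hd qd
  lw lp llam lSz lb lSD lcD lSU lcU lv lv1 lv2 lv3 lv4 lv5.
have [C [[Cfeas Cobj] Csize]] := socp_of_system S lw.
exists C; split.
  split=> -[[[[[[[[[w p] lam] Sz] b] SD] cD] SU] cU] [[[[[v v1] v2] v3] v4] v5]].
    exact: Cfeas.
  exact: Cobj.
rewrite Csize dim_vars.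
have n_gt0 : (0 < n)%N := leq_ltn_trans (leq0n k) (ltn_ord k).
set M := (D + s1 + s2)%N; set N := (_ + L)%N.
have NE : N = (n + M + K + L)%N by rewrite /N /M; lia.
(* Both factors are quadratic in N, where n > 0 lets N ^ 2 absorb the lower
   order terms. *)
have MK_le : (M * K <= N * N)%N by apply: leq_mul; lia.
have ML_le : (M * L <= N * N)%N by apply: leq_mul; lia.
have N_le : (N <= N * N)%N by apply: leq_pmulr; lia.
apply: (@leq_trans ((7 * N ^ 2) * (10 * N ^ 2))).
  by apply: leq_mul; rewrite -mulnn -mulnA; lia.
by rewrite mulnACA -expnD leq_mul2r orbT.
Qed.

Theorem theorem10 (R : realType) (n D s1 s2 L K : nat) (k : 'I_n)
    (dat : sbm_data R n D s1 s2 L)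
    (H1 : 'I_s1 -> 'M[R]_(K, L)) (q1 : 'I_s1 -> 'cV[R]_K)
    (H2 : 'I_s2 -> 'M[R]_(K, L)) (q2 : 'I_s2 -> 'cV[R]_K)
    (Hd : 'I_D -> 'M[R]_(K, L)) (qd : 'I_D -> 'cV[R]_K)
    (Z1_nonempty : forall r, (polyhedron (H1 r) (q1 r) !=set0)%classic)
    (Z2_nonempty : forall r, (polyhedron (H2 r) (q2 r) !=set0)%classic)
    (Zd_nonempty : forall d, (polyhedron (Hd d) (qd d) !=set0)%classic) :
  equivalent_by_completion
    (robust_sbm dat k
       (fun r => polyhedron (H1 r) (q1 r))
       (fun r => polyhedron (H2 r) (q2 r))
       (fun d => polyhedron (Hd d) (qd d)))
    (sbm_counterpart dat k H1 q1 H2 q2 Hd qd)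
  /\
  exists C : socp (robust_vars R n D s1 s2 * dual_vars R D s1 s2 K)%type,
    same_problem (socp_problem C) (sbm_counterpart dat k H1 q1 H2 q2 Hd qd) /\
    (socp_size C <= 100 * (n + D + s1 + s2 + K + L) ^ 4)%N.
Proof.
split; last exact: counterpart_socp.
split=> [x|]; first exact: robust_feasible_completion.
by move=> [[[[[[[[w p] lam] Sz] b] SD] cD] SU] cU] a.
Qed.
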